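(* Let $l\ge 2$. Let $K$ be a finite extension of $\mathbb{Q}$ and let $E_1,E_2,\dots,E_l$ be finite Galois extensions of $\mathbb{Q}$ contained in $\bar{\mathbb{Q}}$. Let $G_i=\mathrm{Gal}(E_i/\mathbb{Q})$ for all $i$. Suppose (1) $E_1\cdots E_k\cap E_{k+1}=K$ for all $1\le k\le l-1$; (2) for every $i$, there exists a set of representatives of the $H_i$-cosets in $G_i$ that is closed under multiplication, where $H_i=\mathrm{Gal}(E_i/K)$. Then for each $1\le i\le l$, $H_i$ is a normal subgroup of $G_i$, and the group $(H_1\times H_2\times\dots\times H_l)\rtimes G_1/H_1$ (for some semidirect product group law) is realizable as the Galois group of $E_1\cdots E_l$ over $\mathbb{Q}$.
   Context: $E_1\cdots E_k$ denotes the compositum in $\bar{\mathbb{Q}}$. ''For some semidirect product group law'' means: for some action of $G_1/H_1$ on $H_1\times\dots\times H_l$ by automorphisms. *)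

(* Defs.v *)
From HB Require Import structures.
From mathcomp Require Import all_boot all_order all_algebra all_fingroup.
From mathcomp Require Import all_solvable all_field.

Set Implicit Arguments.
Unset Strict Implicit.
Unset Printing Implicit Defensive.

Import GRing.Theory.

(* All number fields live in an arbitrary ambient L : splittingFieldType rat,
   i.e. a finite normal extension of Q: finitely many number fields contained
   in the algebraic closure of Q always lie in a common one, and intersections,
   composita and relative Galois groups do not depend on its choice. *)

Section Compositum.
Local Open Scope aspace_scope.

(* Indices start at 0, so this is E_1 ... E_k in 1-based notation. On subfields
   prodv_aspace is the compositum. *)
Definition compositum (L : splittingFieldType rat) (l : nat)
    (E : 'I_l -> {subfield L}) (k : nat) : {subfield L} :=
  \big[@prodv_aspace _ L/1]_(i < l | (i < k)%N) E i.

End Compositum.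

Section Cosets.
Local Open Scope group_scope.

(* Galois groups here multiply by (x * y) a = y (x a), opposite to composition,
   so right cosets of H are the cosets {g o h | h in H}. *)
Definition has_mul_closed_transversal (gT : finGroupType) (G H : {group gT}) :=
  exists T : {set gT},
    is_transversal T (rcosets H G) G /\ {in T &, forall x y, x * y \in T}.

End Cosets.

(* Main.v *)
Require Import Defs.
From HB Require Import structures.
From mathcomp Require Import all_boot all_order all_algebra all_fingroup.
From mathcomp Require Import all_solvable all_field.

(** Let F = E_1 ... E_l, A = Gal(F/Q), N = Gal(F/K), G_i = Gal(E_i/Q) and
    H_i = Gal(E_i/K). The field K is an intersection of two normal fields, hence
    normal over Q, so H_i is normal in G_i and N is normal in A.

    The restrictions r_i : A -> G_i are jointly injective because the E_i
    generate F, and r_i^-1(H_i) = N for every i. The condition on intersections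
    says that restriction maps N onto H_1 x ... x H_l ([gal_lift_family]): an
    automorphism of E_k over K = E_k :&: E_1 ... E_(k-1) lifts to one of F that
    is trivial on E_1 ... E_(k-1) ([normalField_cast_img_cap]), which lets one
    prescribe the restrictions to the E_k one at a time. Hence
    N ~ H_1 x ... x H_l.

    A finite nonempty set closed under multiplication is a group, so the
    transversals are complements T_i of H_i in G_i
    ([mul_closed_transversal_splits]). Then the x in A with r_i x in T_i for
    all i form a complement C of N ([fiber_product_splits]): it meets N
    trivially because T_i meets H_i trivially, and given x in A, the
    H_i-components of the r_i x come from a single n in N, so that n^-1 x is
    in C. Therefore A = N ><| C, where C ~ A/N ~ Gal(K/Q) ~ G_1/H_1, and the
    conjugation action of C on N is carried to the required action
    ([sdprod_by_isog]). *)

Set Implicit Arguments.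
Unset Strict Implicit.
Unset Printing Implicit Defensive.

(** * Complements and semidirect products of finite groups *)

Section Complements.
Local Open Scope group_scope.

(** The representative of the trivial coset has some power equal to 1, so the
    transversal contains 1 and is a subgroup. *)
Lemma mul_closed_transversal_splits (gT : finGroupType) (G H : {group gT}) :
  H \subset G -> has_mul_closed_transversal G H -> [splits G, over H].
Proof.
move=> sHG [T [trT closedT]].
have sTG := transversal_sub trT.
have trTP B : B \in rcosets H G -> exists t, T :&: B = [set t].
  by case/and3P: trT => _ _ /forall_inP trT PB; apply/cards1P/trT.
have [t0 TH] : exists t, T :&: H = [set t].
  by apply: trTP; rewrite -{1}(rcoset1 H) mem_rcosets mulSGid.
have /setIP[Tt0 _] : t0 \in T :&: H by rewrite TH set11.
have T1 : 1 \in T.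
  have TX n : t0 ^+ n.+1 \in T.
    by elim: n => // n IHn; rewrite expgS closedT.
  by rewrite -(expg_order t0) -(prednK (order_gt0 t0)) TX.
have gT_T : group_set T by apply/group_setP.
apply/splitsP; exists (Group gT_T); apply/complP; split=> /=.
  rewrite setIC TH; congr [set _]; apply/eqP.
  by rewrite eq_sym -in_set1 -TH inE T1 group1.
apply/eqP; rewrite eqEsubset mul_subG //=.
apply/subsetP=> g Gg.
have [|t Tt] := trTP (H :* g); first by rewrite mem_rcosets mulSGid.
have /setIP[T_t Hgt] : t \in T :&: (H :* g) by rewrite Tt set11.
have /rcosetP[h Hh ->] : g \in H :* t by rewrite (rcoset_eqP Hgt) rcoset_refl.
exact: mem_mulg.
Qed.

(** Conjugation by C on N, transported along the isomorphisms f : R -> N and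
    g : D -> C, is the action whose external semidirect product is G. *)
Lemma sdprod_by_isog (aT rT gT : finGroupType) (D : {group aT}) (R : {group rT})
    (N C G : {group gT}) :
  N ><| C = G -> R \isog N -> D \isog C ->
  exists to : groupAction D R, [set: sdprod_by to] \isog G.
Proof.
case/sdprodP=> _ defG nNC tiNC /isogP[f injf imf] /isogP[g injg img].
(* An action must be injective at every a, and an automorphism of R must fix
   the complement of R, hence the identity outside of R and D. *)
pose to x a := if (x \in R) && (a \in D) then invm injf (f x ^ g a) else x.
have Jf x a : x \in R -> a \in D -> f x ^ g a \in f @* R.
  move=> Rx Da; rewrite imf memJ_norm -?imf ?mem_morphim // imf.
  by rewrite (subsetP nNC) // -img mem_morphim.
have toR x a : x \in R -> a \in D -> to x a \in R.
  move=> Rx Da; rewrite /to Rx Da.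
  by have /morphimP[z _ Rz ->] := Jf x a Rx Da; rewrite /= invmE.
have fto x a : x \in R -> a \in D -> f (to x a) = f x ^ g a.
  by move=> Rx Da; rewrite {1}/to Rx Da invmK ?Jf.
have to_act : is_action D to.
  split=> [a x y|x a b Da Db].
    have [Da|nDa] := boolP (a \in D); last by rewrite /to (negPf nDa) !andbF.
    have [Rx|nRx] := boolP (x \in R); have [Ry|nRy] := boolP (y \in R).
    - move=> eqxy; apply: (injmP injf) => //; apply: (conjg_inj (g a)).
      by rewrite -!fto // eqxy.
    - move=> eqxy; have := toR x a Rx Da.
      by rewrite eqxy /to (negPf nRy) (negPf nRy).
    - move=> eqxy; have := toR y a Ry Da.
      by rewrite -eqxy /to (negPf nRx) (negPf nRx).
    by rewrite /to (negPf nRx) (negPf nRy).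
  have [Rx|nRx] := boolP (x \in R); last by rewrite /to !(negPf nRx).
  apply: (injmP injf); rewrite ?toR ?groupM //.
  by rewrite !fto ?toR ?groupM // morphM // conjgM.
have to_gact : is_groupAction R (Action to_act).
  move=> a Da; rewrite inE; apply/andP; split.
    apply/subsetP=> x; rewrite inE actpermE /= => tox.
    by apply: contraR tox => nRx; rewrite /to (negPf nRx).
  apply/morphicP=> x y Rx Ry; rewrite !actpermE /=.
  apply: (injmP injf); rewrite ?(toR, groupM) //.
  by rewrite fto ?groupM // !morphM ?toR // conjMg !fto.
exists (GroupAction to_gact).
have actf : {in R & D, morph_act (GroupAction to_gact) 'J f g}.
  by move=> x a Rx Da; rewrite /= fto.
apply/isogP; exists (xsdprod_morphism actf).
  by rewrite injm_xsdprodm injf injg imf img tiNC eqxx.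
by rewrite im_xsdprodm imf img.
Qed.

(** If T i is a complement of H i in G i, the x in A with r i x in T i for all i
    form a complement of N: they meet N trivially by joint injectivity, and
    joint surjectivity on N allows dividing out all the H i-components of an
    element of A at once. *)
Lemma fiber_product_splits (I : finType) (gT : I -> finGroupType)
    (aT : finGroupType) (A N : {group aT}) (G H : forall i, {group gT i})
    (r : forall i, {morphism A >-> gT i}) :
    (forall i, r i @* A \subset G i) ->
    (forall i, r i @*^-1 H i = N) ->
    (forall x, x \in A -> (forall i, r i x = 1) -> x = 1) ->
    (forall h : {dffun forall i, gT i}, h \in setXn H ->
       exists2 x, x \in N & forall i, r i x = h i) ->
    (forall i, [splits G i, over H i]) ->
    N \subset A ->
  setXn H \isog N /\ [splits A, over N].
Proof.
move=> rA defN r_inj r_surj splitG sNA.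
have rN i x : x \in N -> r i x \in H i.
  by rewrite -(defN i) => /morphpreP[].
split.
  pose f x : {dffun forall i, gT i} := [ffun i => r i x].
  have fM : {in N &, {morph f : x y / x * y}}.
    move=> x y /(subsetP sNA) Ax /(subsetP sNA) Ay; apply/ffunP=> i.
    by rewrite !ffunE morphM.
  rewrite isog_sym; apply/isogP; exists (Morphism fM).
    apply/injmP=> x y Nx Ny /ffunP eqf; apply/eqP; rewrite eq_mulgV1; apply/eqP.
    have [Ax Ay] := (subsetP sNA x Nx, subsetP sNA y Ny).
    apply: r_inj => [|i]; first by rewrite groupM ?groupV.
    have := eqf i; rewrite !ffunE morphM ?groupV // morphV // => ->.
    by rewrite mulgV.
  apply/setP=> h; apply/morphimP/idP=> [[x _ Nx ->]|/r_surj[x Nx rx]].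
    by apply/setXnP=> i; rewrite ffunE rN.
  by exists x => //; apply/ffunP=> i; rewrite ffunE rx.
have /fin_all_exists[T complT] i : exists T : {group gT i},
    T \in [complements to H i in G i] by apply/splitsP.
pose C := [group of \bigcap_i r i @*^-1 T i :&: A].
have CP x : reflect (x \in A /\ forall i, r i x \in T i) (x \in C).
  rewrite !inE; apply: (iffP andP) => [[/bigcapP Tx Ax]|[Ax Tx]]; split=> //.
    by move=> i; have /morphpreP[] := Tx i isT.
  by apply/bigcapP=> i _; apply/morphpreP.
apply/splitsP; exists C; apply/complP; split.
  apply/trivgP/subsetP=> x /setIP[Nx /CP[Ax Tx]].
  apply/set1P/r_inj => // i.
  have /complP[tiHT _] := complT i.
  by apply/set1P; rewrite -[[set _]]tiHT inE rN ?Tx.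
apply/eqP; rewrite eqEsubset mul_subG ?subsetIr //=.
apply/subsetP=> x Ax.
(* Splitting each r i x along G i = H i * T i gives the element n of N to be
   divided out. *)
have /fin_all_exists[h hP] i : exists h, h \in H i /\ h^-1 * r i x \in T i.
  have /complP[_ defG] := complT i.
  have : r i x \in H i * T i.
    by rewrite defG (subsetP (rA i)) ?mem_morphim.
  by case/mulsgP=> h t Hh Tt ->; exists h; rewrite mulKg.
have [|n Nn rn] := r_surj [ffun i => h i].
  by apply/setXnP=> i; rewrite ffunE; have [] := hP i.
have An := subsetP sNA n Nn.
rewrite -(mulKVg n x) mem_mulg //; apply/CP; split=> [|i].
  by rewrite groupM ?groupV.
by rewrite morphM ?groupV // morphV // rn ffunE; have [] := hP i.
Qed.

End Complements.

(** * Restriction of automorphisms to normal subfields *)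

Import GRing.Theory Num.Theory.

Section Restriction.
Variables (F0 : fieldType) (L : splittingFieldType F0).
Implicit Types A E F K : {subfield L}.

Lemma normalField_prodv K E F :
  normalField K E -> normalField K F -> normalField K (E * F).
Proof.
move=> /forall_inP nE /forall_inP nF; apply/forall_inP=> x Kx.
by rewrite aimgM (eqP (nE x Kx)) (eqP (nF x Kx)).
Qed.

Lemma normalField_capv K E F :
  normalField K E -> normalField K F -> normalField K (E :&: F).
Proof.
move=> /forall_inP nE /forall_inP nF; apply/forall_inP=> x Kx.
rewrite eqEdim limg_dim_eq ?(eqP (AEnd_lker0 _)) ?capv0 // leqnn andbT.
by rewrite (subv_trans (limg_cap _ _ _)) // (eqP (nE x Kx)) (eqP (nF x Kx)).
Qed.

(** Natural irrationalities: an element of E fixed by Gal(F/A) lies in A since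
    F is Galois over A, so E :&: A is the fixed field of the image of Gal(F/A),
    and the Galois correspondence for E identifies this image. *)
Lemma normalField_cast_img_cap K A E F (galKF : galois K F)
    (sKEF : (K <= E <= F)%VS) (nKE : normalField K E) :
    (K <= A)%VS -> (A <= F)%VS ->
  (normalField_cast_morphism sKEF nKE @* 'Gal(F / A)
     = 'Gal(E / E :&: A))%g.
Proof.
move=> sKA sAF; have galAF : galois A F by apply: galoisS galKF; rewrite sKA.
have sAK := galS F sKA.
have [sKE sEF] := andP sKEF.
rewrite -[LHS]gal_fixedField; congr 'Gal(E / _)%g.
apply/vspaceP=> a; apply/idP/idP.
  case/mem_fixedFieldP=> Ea fix_a; rewrite memv_cap Ea /=.
  rewrite -(galois_fixedField galAF); apply/fixedFieldP=> [|x Ax].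
    exact: subvP sEF a Ea.
  have Kx := subsetP sAK x Ax.
  rewrite -(normalField_cast_eq sKEF nKE Kx) //.
  exact/fix_a/(mem_morphim (normalField_cast_morphism sKEF nKE)).
case/memv_capP=> Ea Aa; apply/fixedFieldP=> // _ /morphimP[x Kx Ax ->].
by rewrite /= (normalField_cast_eq sKEF nKE Kx) // (fixed_gal sAF Ax).
Qed.

End Restriction.

(** * Composita of Galois extensions of the rationals *)

Section Composita.
Variable (L : splittingFieldType rat).

(** Separability is automatic in characteristic 0. *)
Lemma normal_galois (K E : {subfield L}) :
  (K <= E)%VS -> normalField K E -> galois K E.
Proof.
move=> sKE nKE; rewrite /galois sKE nKE andbT /=.
apply/separableP=> a _; apply: pcharf0_separable.
by move=> p; rewrite pchar_lalg pchar_num.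
Qed.

Variables (l : nat) (E : 'I_l -> {subfield L}).

Lemma sub_compositum (k : nat) (i : 'I_l) :
  (i < k)%N -> (E i <= compositum E k)%VS.
Proof.
rewrite /compositum => lt_ik.
have asval_big (P : pred 'I_l) :
    \big[@prodv_aspace _ L/1%AS]_(j < l | P j) E j
      = \big[@prodv _ L/1%VS]_(j < l | P j) E j :> {vspace L}.
  exact: (big_morph (@asval _ L)).
by rewrite asval_big (bigD1 i) //= -asval_big field_subvMr.
Qed.

Lemma compositum_sub (k : nat) (A : {subfield L}) :
  (forall i : 'I_l, (i < k)%N -> (E i <= A)%VS) -> (compositum E k <= A)%VS.
Proof.
move=> sEA; rewrite /compositum; elim/big_ind: _ => [|B C sBA sCA|//].
  exact: sub1v.
exact: prodv_sub.
Qed.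

Lemma normalField_compositum (k : nat) (K : {subfield L}) :
  (forall i : 'I_l, (i < k)%N -> normalField K (E i)) ->
  normalField K (compositum E k).
Proof.
move=> nE; rewrite /compositum; elim/big_ind: _ => [|B C|//].
  by apply/forall_inP=> x _; rewrite aimg1.
exact: normalField_prodv.
Qed.

(** Linear disjointness over K, in the form needed to lift automorphisms.
    The factor K in K * compositum E k is there for k = 0, where the compositum
    is the base field and may be smaller than K. *)
Lemma gal_lift_family (K F : {subfield L}) :
    galois K F ->
    (forall i, K <= E i <= F)%VS -> (forall i, normalField K (E i)) ->
    (forall k : 'I_l, E k :&: (K * compositum E k) = K)%VS ->
  forall h : (forall i, gal_of (E i)), (forall i, h i \in 'Gal(E i / K)%g) ->
  exists2 x, x \in 'Gal(F / K)%g & forall i, normalField_cast (E i) x = h i.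
Proof.
move=> galKF sKEF nE capE h Hh.
suffices /(_ l (leqnn l))[x Kx xh] : forall k, (k <= l)%N ->
    exists2 x, x \in 'Gal(F / K)%g
             & forall i : 'I_l, (i < k)%N -> normalField_cast (E i) x = h i.
  by exists x => // i; apply: xh.
elim=> [_|k IHk lt_kl]; first by exists 1%g; rewrite ?group1.
have [x Kx xh] := IHk (ltnW lt_kl).
have sKF : (K <= F)%VS by case/and3P: galKF.
pose j := Ordinal lt_kl; pose A := (K * compositum E j)%AS.
have sKA : (K <= A)%VS by apply: field_subvMr.
have sAF : (A <= F)%VS.
  apply: prodv_sub => //; apply: compositum_sub => i _.
  by have /andP[] := sKEF i.
pose r i := normalField_cast_morphism (sKEF i) (nE i).
(* Correct x by an automorphism u that is trivial on the previous fields and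
   makes up the difference on E j; products in Galois groups act from left to
   right, so u * x applies u first. *)
have : (h j * (r j x)^-1)%g \in (r j @* 'Gal(F / A))%g.
  rewrite normalField_cast_img_cap // (capE j) groupM ?groupV ?Hh //=.
  by rewrite -(normalField_img galKF (sKEF j) (nE j)) mem_morphim.
case/morphimP=> u Ku Au def_u.
exists (u * x)%g; first exact: groupM.
move=> i; rewrite ltnS leq_eqVlt => /predU1P[eq_ik|lt_ik].
  have -> : i = j by apply: val_inj.
  by rewrite [LHS](morphM (r j)) // -def_u mulgKV.
rewrite [LHS](morphM (r i)) // [r i x]xh // (_ : r i u = 1%g) ?mul1g //.
apply/eqP/gal_eqP=> a Ea; rewrite gal_id.
rewrite [LHS](normalField_cast_eq (sKEF i) (nE i)) //.
apply: (fixed_gal sAF Au); apply: subvP Ea.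
exact: subv_trans (sub_compositum lt_ik) (field_subvMl _ _).
Qed.

End Composita.

(** * The Galois group of the compositum *)

Theorem theorem2p4 (l : nat) (hl : (2 <= l)%N) (L : splittingFieldType rat)
    (K : {subfield L}) (E : 'I_l -> {subfield L})
    (galE : forall i : 'I_l, galois 1 (E i))
    (capK : forall k : 'I_l, (1 <= k)%N ->
       (compositum E k :&: E k)%AS = K)
    (transE : forall i : 'I_l,
       has_mul_closed_transversal 'Gal(E i / 1)%G 'Gal(E i / K)%G) :
  let i1 : 'I_l := Ordinal (ltnW hl) in
  (forall i : 'I_l, ('Gal(E i / K) <| 'Gal(E i / 1))%g) /\
  galois 1 (compositum E l) /\
  exists to : groupAction ('Gal(E i1 / 1) / 'Gal(E i1 / K))%g
                          (setXn (fun i : 'I_l => 'Gal(E i / K)%g)),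
    ([set: sdprod_by to] \isog 'Gal(compositum E l / 1))%g.
Proof.
move=> i1; pose F := compositum E l; pose i2 : 'I_l := Ordinal hl.
have nE i : normalField 1 (E i) by case/and3P: (galE i).
have capKv (k : 'I_l) : (1 <= k)%N -> (compositum E k :&: E k)%VS = K.
  by move=> /capK/(congr1 asval).
have sKC (k : 'I_l) : (1 <= k)%N -> (K <= compositum E k)%VS.
  by move/capKv => <-; apply: capvSl.
(* The hypothesis at k = 1 also covers E i1, which is compositum E 1. *)
have sKE i : (K <= E i)%VS.
  have [i_gt0|] := ltnP 0 i; first by rewrite -(capKv i) ?capvSr.
  rewrite leqn0 => /eqP i_eq0; apply: subv_trans (sKC i2 isT) _.
  apply: compositum_sub => j; rewrite ltnS leqn0 => /eqP j_eq0.
  by rewrite (_ : j = i) //; apply: val_inj; rewrite /= j_eq0 i_eq0.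
have nK : normalField 1 K.
  rewrite -(capKv i2 isT) normalField_capv //.
  by apply: normalField_compositum => i _; apply: nE.
have galF : galois 1 F.
  apply: normal_galois; first exact: sub1v.
  by apply: normalField_compositum => i _; apply: nE.
have sEF i : (E i <= F)%VS by apply: sub_compositum.
have sKF : (K <= F)%VS := subv_trans (sKE i1) (sEF i1).
have s1EF i : (1 <= E i <= F)%VS by rewrite sub1v sEF.
have s1KE i : (1 <= K <= E i)%VS by rewrite sub1v sKE.
have galKF : galois K F by apply: galoisS galF; rewrite sub1v.
have nsHG i : ('Gal(E i / K) <| 'Gal(E i / 1))%g.
  exact: normalField_normal (s1KE i) nK.
split=> //; split=> //.
pose r i := normalField_cast_morphism (s1EF i) (nE i).
pose N := 'Gal(F / K)%G.
pose G i := 'Gal(E i / 1)%G; pose H i := 'Gal(E i / K)%G.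
have sNA : N \subset 'Gal(F / 1)%G by apply: galS; apply: sub1v.
have rG i : (r i @* 'Gal(F / 1) = G i)%g by apply: normalField_img.
have rE i x a : x \in 'Gal(F / 1)%g -> a \in E i -> r i x a = x a.
  by move=> Ax; apply: normalField_cast_eq (s1EF i) (nE i) _ Ax a.
have rN i : (r i @*^-1 H i = N)%g.
  apply/setP=> x; apply/morphpreP/idP=> [[Ax Hx]|Nx].
    rewrite gal_kHom //; apply/kAHomP=> a Ka.
    by rewrite -(rE i) ?(subvP (sKE i)) // (fixed_gal (sKE i) Hx).
  have Ax := subsetP sNA x Nx; split=> //.
  rewrite gal_kHom //; apply/kAHomP=> a Ka.
  by rewrite rE ?(subvP (sKE i)) // (fixed_gal sKF Nx).
have r_inj x : x \in 'Gal(F / 1)%g -> (forall i, r i x = 1%g) -> x = 1%g.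
  move=> Ax rx1; apply/eqP/gal_eqP=> a Fa; rewrite gal_id.
  suffices /subvP/(_ a Fa)/mem_fixedFieldP[_] : (F <= fixedField [set x])%VS.
    by apply; rewrite set11.
  apply: compositum_sub => i _; apply/subvP=> b Eb.
  apply/fixedFieldP=> [|_ /set1P->]; first exact: subvP (sEF i) b Eb.
  by rewrite -(rE i) // rx1 gal_id.
have r_surj (h : {dffun forall i, gal_of (E i)}) :
    h \in setXn H -> exists2 x, x \in N & forall i, r i x = h i.
  move/setXnP=> Hh; apply: gal_lift_family => // [i|i|k].
  - by rewrite sKE sEF.
  - exact: normalFieldS (sub1v _) (nE i).
  have [k_gt0|] := ltnP 0 k.
    rewrite (_ : (K * _)%VS = compositum E k) 1?capvC ?capKv //.
    by apply/eqP; rewrite eqEsubv prodv_sub ?sKC //= field_subvMl.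
  rewrite leqn0 => /eqP k_eq0.
  rewrite (_ : (K * _)%VS = K); first exact/capv_idPr.
  apply/eqP; rewrite eqEsubv prodv_sub ?field_subvMr //=.
  by apply: compositum_sub => j; rewrite k_eq0.
have splitG i : [splits G i, over H i]%g.
  exact: mul_closed_transversal_splits (normal_sub (nsHG i)) (transE i).
have rGs i : (r i @* 'Gal(F / 1) \subset G i)%g by rewrite rG.
have [isoN /splitsP[C complC]] :=
  fiber_product_splits rGs rN r_inj r_surj splitG sNA.
have nsNA : (N <| 'Gal(F / 1))%g.
  by apply: normalField_normal nK; rewrite sub1v.
have defA : (N ><| C = 'Gal(F / 1))%g.
  by apply/(sdprod_normal_complP nsNA); rewrite complgC.
apply: (sdprod_by_isog defA isoN).
rewrite isog_sym (isog_transl _ (sdprod_isog defA)).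
rewrite (isog_transl _ (normalField_isog galF _ nK)) ?sub1v //.
have isoK := normalField_isog (galE i1) (s1KE i1) nK.
by rewrite isog_sym; exact isoK.
Qed.
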